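(* Let $n\geq 2$ be an integer and let $X$ be an $n$-Urysohn quasiregular topological space. Then $|X|\leq \pi\chi(X)^{\,c(X)\cdot wt(X)\cdot n\text{-}\psi_c(X)}$.
   Context: Throughout $n\ge 2$ is an integer. The Urysohn number $U(X)$ of a space $X$ is the least cardinal $\kappa$ such that for every $A\subseteq X$ with $|A|\geq\kappa$ there exist open neighbourhoods $U_a$ of $a$ ($a\in A$) with $\bigcap_{a\in A}\overline{U_a}=\emptyset$. $X$ is $n$-Urysohn if $U(X)\leq n$. $X$ is quasiregular if for each nonempty open set $U$ there is a nonempty open set $V$ with $\overline{V}\subseteq U$. For an $n$-Urysohn space $X$, the $n$-closed pseudocharacter $n\text{-}\psi_c(X)$ is the minimum infinite cardinal $\kappa$ such that for each point $x\in X$ there is a collection $\{V(\alpha,x):\alpha<\kappa\}$ of open neighbourhoods of $x$ such that whenever $x_1,\dots,x_n\in X$ are $n$ different points, $\bigcap_{\alpha<\kappa}\overline{V(\alpha,x_1)}\cap\dots\cap\bigcap_{\alpha<\kappa}\overline{V(\alpha,x_n)}=\emptyset$. The weak tightness $wt(X)$ is the least infinite cardinal $\kappa$ for which there is a cover $\mathcal{C}$ of $X$ such that $|\mathcal{C}|\leq 2^\kappa$ and, for all $C\in\mathcal{C}$, $t(C)\leq\kappa$ (tightness of the subspace $C$) and $X=\bigcup_{B\in[C]^{\leq 2^\kappa}}\overline{B}$, where $[C]^{\leq 2^\kappa}$ is the family of subsets of $C$ of cardinality at most $2^\kappa$. $\pi\chi(X)$ is the $\pi$-character and $c(X)$ the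 cellularity of $X$; $\pi\chi$, $c$ and $t$ are multiplied by $\omega$ (so they are always infinite). *)

(* Defs.v *)
From mathcomp Require Import all_boot.
From mathcomp Require Import boolp classical_sets functions cardinality.
From mathcomp Require Import topology.

Set Implicit Arguments.
Unset Strict Implicit.
Unset Printing Implicit Defensive.

Local Open Scope classical_set_scope.
Local Open Scope card_scope.

(* Cardinal numbers are represented by types up to [#=]: the cardinal of a    *)
(* type K is that of [set: K], the product of K and L is K * L, the power     *)
(* K ^ L is L -> K, and 2 ^ K is K -> bool.                                   *)

Definition least_card (P : Type -> Prop) (K : Type) : Prop :=
  P K /\ forall L : Type, P L -> [set: K] #<= [set: L].

(* The value [False] is junk: it is only taken when no type satisfies P, see  *)
(* [card_minP].                                                               *)
Definition card_min (P : Type -> Prop) : Type :=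
  if pselect (exists K, least_card P K) is left e then sval (cid e) else False.

Definition infinite_card (K : Type) : Prop := infinite_set [set: K].

Section card_min_theory.

Lemma card_le_inj (K L : Type) (f : K -> L) :
  injective f -> [set: K] #<= [set: L].
Proof.
move=> fI; apply: card_le_trans (card_leT (range f)).
have /card_eqPle[] // : range f #= [set: K].
by apply: inj_card_eq => x y _ _; exact: fI.
Qed.

Lemma card_le_set (K : Type) (A : set K) : A #<= [set: K].
Proof. exact: subset_card_le. Qed.

Lemma infinite_card_sum_nat (K : Type) : infinite_card (nat + K).
Proof. by apply/infiniteP/(@card_le_inj _ _ inl) => ? ? []. Qed.

Lemma card_le_sum_nat (K : Type) : [set: K] #<= [set: nat + K].
Proof. by apply: (@card_le_inj _ _ inr) => ? ? []. Qed.

Lemma card_le_pow (K : Type) : [set: K] #<= [set: K -> bool].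
Proof.
apply: (@card_le_inj _ _ (fun x y => `[< x = y >])) => x y /(congr1 (@^~ y)).
by move=> xy; apply/asboolP; rewrite xy; exact/asboolP.
Qed.

Lemma Cantor (K : Type) : ~ ([set: set K] #<= [set: K]).
Proof.
move=> /card_leP[f].
pose g S : K := val (f (SigSub (mem_set (I : [set: set K] S)))).
have gI : injective g.
  move=> A B /val_inj fAB.
  have /(congr1 val) // := @inj _ _ _ f _ _ (mem_set I) (mem_set I) fAB.
pose D : set K := [set g S | S in [set S | ~ S (g S)]].
have [Dg|nDg] := pselect (D (g D)).
  by have [S nS /gI SD] := Dg; apply: nS; rewrite SD.
by apply: (nDg); exists D.
Qed.

(* In a nonempty family of types, one is of least cardinality. *)
Lemma exists_least_family (I : Type) (A : I -> Type) (i0 : I) :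
  exists i, forall j, [set: A i] #<= [set: A j].
Proof.
pose T := forall i, A i.
pose P (M : set T) :=
  forall f g, M f -> M g -> forall i, f i = g i -> f = g.
have [|M [MP Mmax]] := @Zorn_bigcup T P.
  move=> F FP Ftot f g [X FX Xf] [Y FY Yg] i.
  by have [XY|YX] := Ftot _ _ FX FY; [apply: (FP Y) => //; apply: XY|
    apply: (FP X) => //; apply: YX].
have [[i iM]|noM] := pselect (exists i, forall a, exists2 f, M f & f i = a).
  exists i => j; have /choice[g gP] : forall a, exists f, M f /\ f i = a.
    by move=> a; have [f ? ?] := iM a; exists f.
  apply: (@card_le_inj _ _ (fun a => g a j)) => a b gab.
  have [Ma ga] := gP a; have [Mb gb] := gP b.
  by rewrite -ga -gb (MP _ _ Ma Mb _ gab).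
have /all_tag[h hP] : forall i, {a : A i | forall f, M f -> f i <> a}.
  move=> i; apply/cid; apply: contrapT => no; apply: noM; exists i => a.
  apply: contrapT => noa; apply: no; exists a => f Mf fa.
  by apply: noa; exists f.
have Mh : ~ M h by move=> /(hP i0).
exfalso; apply: (Mmax (M `|` [set h])).
  split=> [f Mf|sub]; first by left.
  by apply/Mh/sub; right.
move=> f g [Mf|->] [Mg|->] i //; first exact: MP.
- by move=> /(hP i f Mf).
- by move=> /esym /(hP i g Mg).
Qed.

Lemma card_le_total (K L : Type) :
  [set: K] #<= [set: L] \/ [set: L] #<= [set: K].
Proof.
have [[] le] := @exists_least_family bool (fun b => if b then K else L) true.
- by left; exact: (le false).
- by right; exact: (le true).
Qed.

Lemma card_minP (P : Type -> Prop) :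
  (exists K, P K) -> least_card P (card_min P).
Proof.
move=> [K0 PK0]; rewrite /card_min; case: pselect => [e|[]].
  exact: svalP (cid e).
pose I := {S : set K0 | exists K, P K /\ [set: K] #= S}.
have IT : exists K, P K /\ [set: K] #= [set: K0] by exists K0.
have [[S [K [PK KS]]] le] := @exists_least_family I (fun i => sval i)
  (exist _ setT IT).
have leK (S' : set K0) L : P L -> [set: L] #= S' -> [set: K] #<= [set: L].
  move=> PL LS; have /= := le (exist _ S' (ex_intro _ L (conj PL LS))).
  by rewrite (card_le_eql (card_setT _)) (card_le_eqr (card_setT _))
    -(card_le_eql KS) -(card_le_eqr LS).
exists K; split=> // L PL; have [/card_subP[S' S'L _]|K0L] := card_le_total L K0.
  exact/(leK S')/card_esym.
by apply: card_le_trans K0L; apply: leK PK0 _.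
Qed.

End card_min_theory.

Section cardinal_functions.
Variable X : topologicalType.
Implicit Types (K : Type) (n : nat).

Definition quasiregular : Prop :=
  forall U : set X, open U -> U !=set0 ->
    exists V : set X, [/\ open V, V !=set0 & closure V `<=` U].

Definition urysohn_prop K : Prop :=
  forall A : set X, [set: K] #<= A ->
    exists2 U : X -> set X, (forall a, A a -> open_nbhs a (U a)) &
      \bigcap_(a in A) closure (U a) = set0.

Definition urysohn_number : Type := card_min urysohn_prop.

Definition n_urysohn n : Prop := [set: urysohn_number] #<= `I_n.

Definition n_closed_pseudo_prop n K : Prop :=
  exists2 V : K -> X -> set X, (forall alpha x, open_nbhs x (V alpha x)) &
    forall x : 'I_n -> X, injective x ->
      \bigcap_(i in [set: 'I_n]) \bigcap_(alpha in [set: K])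
        closure (V alpha (x i)) = set0.

Definition n_closed_pseudochar n : Type :=
  card_min (fun K => infinite_card K /\ n_closed_pseudo_prop n K).

Definition local_pi_base (x : X) (B : set (set X)) : Prop :=
  (forall V, B V -> open V /\ V !=set0) /\
  (forall U, open_nbhs x U -> exists2 V, B V & V `<=` U).

Definition pi_char_at (x : X) : Type :=
  card_min (fun K => exists2 B, local_pi_base x B & B #= [set: K]).

(* Suprema multiplied by omega are least infinite upper bounds. *)
Definition pi_char : Type :=
  card_min (fun K => infinite_card K /\
    forall x, [set: pi_char_at x] #<= [set: K]).

Definition cellular_family (G : set (set X)) : Prop :=
  (forall V, G V -> open V /\ V !=set0) /\ trivIset G id.

Definition cellularity : Type :=
  card_min (fun K => infinite_card K /\
    forall G, cellular_family G -> G #<= [set: K]).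

Definition tightness_prop K : Prop :=
  forall (A : set X) (x : X), closure A x ->
    exists B : set X, [/\ B `<=` A, B #<= [set: K] & closure B x].

Definition tightness : Type :=
  card_min (fun K => infinite_card K /\ tightness_prop K).

End cardinal_functions.

(* In [tightness C], the set C is coerced to the type of its elements, which  *)
(* carries the subspace topology; closures are taken in X.                    *)
Definition weak_tightness_prop (X : topologicalType) (K : Type) : Prop :=
  exists CC : set (set X),
    [/\ \bigcup_(C in CC) C = setT,
        CC #<= [set: K -> bool] &
        forall C : set X, CC C ->
          [set: tightness C] #<= [set: K] /\
          \bigcup_(B in [set B | B `<=` C /\ B #<= [set: K -> bool]])
            closure B = setT].

Definition weak_tightness (X : topologicalType) : Type :=
  card_min (fun K => infinite_card K /\ weak_tightness_prop X K).

Arguments quasiregular : clear implicits.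
Arguments urysohn_prop : clear implicits.
Arguments urysohn_number : clear implicits.
Arguments n_urysohn : clear implicits.
Arguments n_closed_pseudo_prop : clear implicits.
Arguments n_closed_pseudochar : clear implicits.
Arguments pi_char : clear implicits.
Arguments cellularity : clear implicits.
Arguments tightness_prop : clear implicits.
Arguments tightness : clear implicits.

(* All these minima are attained. *)
Section cardinal_functions_attained.
Variable X : topologicalType.

Lemma urysohn_numberP : least_card (urysohn_prop X) (urysohn_number X).
Proof.
apply: card_minP; exists (set X) => A XA.
by case: (@Cantor X); apply: card_le_trans XA (card_le_set A).
Qed.

Lemma n_urysohnP (n : nat) : n_urysohn X n -> urysohn_prop X 'I_n.
Proof.
have [UX _] := urysohn_numberP; move=> Un A nA; apply: UX.
by apply: card_le_trans nA; rewrite -(card_le_eqr card_II).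
Qed.

Lemma n_closed_pseudocharP (n : nat) : n_urysohn X n ->
  least_card (fun K => infinite_card K /\ n_closed_pseudo_prop X n K)
    (n_closed_pseudochar X n).
Proof.
move=> /n_urysohnP Un; apply: card_minP; exists (nat + set X)%type.
split; first exact: infinite_card_sum_nat.
pose V (a : nat + set X) x :=
  if a is inr W then if pselect (open_nbhs x W) then W else setT else setT.
exists V => [a x|x xI].
  rewrite /V; case: a => [k|W]; first exact (open_nbhsT x).
  by case: (pselect (open_nbhs x W)) => ? //; exact (open_nbhsT x).
have [|U Unbhs U0] := Un (range x).
  have /card_eqPle[] // : range x #= [set: 'I_n].
  by apply: inj_card_eq => i j _ _; exact: xI.
rewrite -subset0 -U0 => y Vy _ [i _ <-].
have := Vy i I (inr (U (x i))) I; rewrite /V.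
case: (pselect (open_nbhs (x i) (U (x i)))) => // -[].
by apply: Unbhs; exists i.
Qed.

Lemma pi_char_atP (x : X) :
  least_card (fun K => exists2 B, local_pi_base x B & B #= [set: K])
    (pi_char_at x).
Proof.
apply: card_minP; pose B := [set V : set X | open V /\ V !=set0].
exists B; exists B; last exact: card_setT_sym.
split=> // U [oU Ux].
by exists U => //; split=> //; exists x.
Qed.

Lemma pi_charP : least_card (fun K => infinite_card K /\
  forall x : X, [set: pi_char_at x] #<= [set: K]) (pi_char X).
Proof.
apply: card_minP; exists (nat + set X)%type.
split=> [|x]; first exact: infinite_card_sum_nat.
have [[B _ BK] _] := pi_char_atP x.
rewrite -(card_le_eql BK).
exact: card_le_trans (card_le_set _) (card_le_sum_nat _).
Qed.

Lemma cellularityP : least_card (fun K => infinite_card K /\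
  forall G : set (set X), cellular_family G -> G #<= [set: K]) (cellularity X).
Proof.
apply: card_minP; exists (nat + set X)%type.
split=> [|G _]; first exact: infinite_card_sum_nat.
exact: card_le_trans (card_le_set _) (card_le_sum_nat _).
Qed.

Lemma tightnessP :
  least_card (fun K => infinite_card K /\ tightness_prop X K) (tightness X).
Proof.
apply: card_minP; exists (nat + X)%type.
split=> [|A x Ax]; first exact: infinite_card_sum_nat.
by exists A; split=> //; apply: card_le_trans (card_le_set _) (card_le_sum_nat _).
Qed.

End cardinal_functions_attained.

Lemma weak_tightnessP (X : topologicalType) :
  least_card (fun K => infinite_card K /\ weak_tightness_prop X K)
    (weak_tightness X).
Proof.
apply: card_minP; pose T : set X := setT.
exists (nat + tightness T + X)%type; split.
  apply/infiniteP/(@card_le_inj _ _ (fun k => inl (inl k))).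
  by move=> ? ? [].
have powX : [set: X] #<= [set: nat + tightness T + X -> bool].
  apply: card_le_trans (card_le_pow _).
  by apply: (@card_le_inj _ _ inr) => ? ? [].
exists [set T]; split=> [||_ ->]; first by rewrite bigcup_set1.
  have -> : [set T] = (fun=> T) @` [set: unit].
    by apply/seteqP; split=> [_ ->|_ [_ _ <-]] //; exists tt.
  apply: card_le_trans (card_image_le _ _) _.
  by apply: (@card_le_inj _ _ (fun _ _ => true)) => -[] [].
split.
  by apply: (@card_le_inj _ _ (fun k => inl (inr k))) => ? ? [].
apply/seteqP; split=> // x _; exists T; first by split.
exact: subset_closure.
Qed.

(* Main.v *)
Require Import Defs.
From mathcomp Require Import all_boot.
From mathcomp Require Import boolp classical_sets functions cardinality.
From mathcomp Require Import topology.

Local Open Scope classical_set_scope.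
Local Open Scope card_scope.

(** Write C, W, P for the cellularity, the weak tightness and the n-closed
    pseudocharacter, L for the pi-character, K = C * W * P and M = K -> L.

    Fix local pi-bases indexed by L at all points. The set D obtained by
    closing a point under the C-ary operations that choose a point outside
    the closure of a union of basic open sets b(w c, l c), c in C, has at most
    L ^ C elements, because its elements are values of well-founded trees that
    branch over C ([closed_under_operations]). If D were not dense,
    quasiregularity would give a nonempty open V whose closure misses the
    closure of D; a maximal disjoint family of basic sets at points of D that
    miss V has at most C members, its union accumulates at every point of D
    but misses V, so the point chosen outside the closure of that union
    belongs to D, a contradiction ([quasiregular_density]).

    Weak tightness replaces D by a set E of at most 2 ^ W * 2 ^ W * L ^ C
    points such that every point of X is in the closure of at most W points of
    E ([weak_tightness_net]): in each C' of the cover, E meets C' in a dense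
    set, and C' has tightness at most W.

    Finally x is coded by the traces on its W-sequence in E of its
    neighbourhoods V(alpha, x), alpha in P. If distinct points x_1, ..., x_n
    had the same code, then x_1 would be in the closure of each V(alpha, x_i),
    which is excluded; so the fibres of the code are finite and X has at most M ^ (P * W) * nat elements
    ([card_le_closed_pseudochar]). The bound is M itself, because K * K and
    seq K are no larger than K ([card_square], [card_seq]). *)

(** * Injections and enumerations *)

Lemma card_le_setTP (K L : Type) :
  [set: K] #<= [set: L] <-> exists f : K -> L, injective f.
Proof.
split=> [/card_leP[f]|[f /card_le_inj//]].
exists (fun x => val (f (SigSub (mem_set (I : [set: K] x))))) => x y /val_inj fxy.
by have /(congr1 val) := @inj _ _ _ f _ _ (mem_set I) (mem_set I) fxy.
Qed.

Lemma sval_inj (T : Type) (P : T -> Prop) : injective (@sval T P).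
Proof. by move=> x y; apply: eq_sig_hprop => z; exact: Prop_irrelevance. Qed.

Lemma card_le_range (K T : Type) (A : set T) :
  A !=set0 -> A #<= [set: K] -> exists g : K -> T, range g = A.
Proof.
move=> A0 /pfcard_geP[AE|[g]]; first by case: A0 => x; rewrite AE.
by exists g; apply: image_eq.
Qed.

Lemma infinite_card_injP (K : Type) :
  infinite_card K <-> exists u : nat -> K, injective u.
Proof. by rewrite /infinite_card infiniteP; exact: card_le_setTP. Qed.

(** * Arithmetic of infinite cardinals *)

Lemma card_le_prod (K K' L L' : Type) :
  [set: K] #<= [set: K'] -> [set: L] #<= [set: L'] ->
  [set: K * L] #<= [set: K' * L'].
Proof.
move=> /card_le_setTP[f fI] /card_le_setTP[g gI].
apply/card_le_setTP; exists (fun p => (f p.1, g p.2)).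
by move=> [x y] [x' y'] [/fI -> /gI ->].
Qed.

Lemma card_le_option (K L : Type) :
  [set: K] #<= [set: L] -> [set: option K] #<= [set: option L].
Proof.
move=> /card_le_setTP[f fI]; apply/card_le_setTP; exists (omap f).
by move=> [x|] [y|] //= [/fI ->].
Qed.

Lemma card_le_fun (K K' L L' : Type) : L' ->
  [set: K] #<= [set: K'] -> [set: L] #<= [set: L'] ->
  [set: K -> L] #<= [set: K' -> L'].
Proof.
move=> l0 /card_le_setTP[f fI] /card_le_setTP[g gI]; apply/card_le_setTP.
pose F (h : K -> L) (k' : K') : L' :=
  if pselect (exists k, f k = k') is left e then g (h (sval (cid e))) else l0.
exists F => h h' hh'; apply/funext => k; apply: gI.
move: (congr1 (@^~ (f k)) hh'); rewrite /F; case: pselect => [e|[]]; last by exists k.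
by case: (cid e) => k' /= /fI ->.
Qed.

(** The domain of a partial binary operation given by its graph M, read off
    the diagonal: the x such that x * x is defined. *)
Definition square_dom (K : Type) (M : set (K * K * K)) : set K :=
  [set x | exists y, M (x, x, y)].

(** M is the graph of an injection of A * A into A, where A = [square_dom K M]
    is empty or infinite. The empty graph is allowed so that the union of an
    empty chain qualifies. *)
Definition square_graph (K : Type) (M : set (K * K * K)) : Prop :=
  [/\ (forall p y y', M (p, y) -> M (p, y') -> y = y'),
      (forall p p' y, M (p, y) -> M (p', y) -> p = p'),
      (forall x x' y, M (x, x', y) ->
         [/\ square_dom K M x, square_dom K M x' & square_dom K M y]),
      (forall x x', square_dom K M x -> square_dom K M x' ->
         exists y, M (x, x', y)) &
      (M !=set0 -> infinite_set (square_dom K M))].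

Lemma square_graph_bigcup (K : Type) (F : set (set (K * K * K))) :
  F `<=` square_graph K -> total_on F subset ->
  square_graph K (\bigcup_(M in F) M).
Proof.
move=> FG Ftot.
have two M M' : F M -> F M' -> exists N, [/\ F N, M `<=` N & M' `<=` N].
  by move=> FM FM'; have [?|?] := Ftot _ _ FM FM'; [exists M'|exists M]; split.
have domU M : F M -> square_dom K M `<=` square_dom K (\bigcup_(M in F) M).
  by move=> FM x [y xy]; exists y; exists M.
split.
- move=> p y y' [M FM My] [M' FM' My']; have [N [FN MN MN']] := two _ _ FM FM'.
  by have [h _ _ _ _] := FG _ FN; apply: h (MN _ My) (MN' _ My').
- move=> p y y' [M FM My] [M' FM' My']; have [N [FN MN MN']] := two _ _ FM FM'.
  by have [_ h _ _ _] := FG _ FN; apply: h (MN _ My) (MN' _ My').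
- move=> x x' y [M FM Mx]; have [_ _ h _ _] := FG _ FM.
  by have [? ? ?] := h _ _ _ Mx; split; apply: domU FM _ _.
- move=> x x' [y [M FM Mx]] [y' [M' FM' Mx']].
  have [N [FN MN MN']] := two _ _ FM FM'; have [_ _ _ h _] := FG _ FN.
  have [||z Nz] := h x x'; [by exists y; apply: MN|by exists y'; apply: MN'|].
  by exists z; exists N.
- move=> [p [M FM Mp]]; have [_ _ _ _ h] := FG _ FM.
  by apply: sub_infinite_set (domU _ FM) (h _); exists p.
Qed.

Lemma square_graph_nat (K : Type) (u : nat -> K) : injective u ->
  exists2 M, square_graph K M & M !=set0.
Proof.
move=> uI; have [pr prI] : exists f : nat * nat -> nat, injective f.
  by apply/card_le_setTP; have /card_eqPle[] := card_nat2.
pose M := [set t : K * K * K | exists i j, t = (u i, u j, u (pr (i, j)))].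
have domM x : square_dom K M x <-> exists i, x = u i.
  split=> [[y [i [j [-> _ _]]]]|[i ->]]; first by exists i.
  by exists (u (pr (i, i))); exists i, i.
exists M; last by exists (u 0, u 0, u (pr (0, 0)))%N; exists 0%N, 0%N.
split.
- by move=> p y y' [i [j [-> ->]]] [i' [j' [/uI -> /uI -> ->]]].
- by move=> p p' y [i [j [-> ->]]] [i' [j' [-> /uI/prI[-> ->]]]].
- by move=> x x' y [i [j [-> -> ->]]]; split; apply/domM; eexists.
- move=> x x' /domM[i ->] /domM[j ->].
  by exists (u (pr (i, j))); exists i, j.
- move=> _; apply/infiniteP.
  have uR : range u `<=` square_dom K M by move=> _ [i _ <-]; apply/domM; exists i.
  apply: card_le_trans (subset_card_le uR).
  by have /card_eqPle[] : range u #= [set: nat]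
    by apply: inj_card_eq => i j _ _; exact: uI.
Qed.

(** Hessenberg's theorem. A maximal [square_graph] lives on a set A as large
    as K: otherwise the complement of A contains a copy B of A, and the new
    products A * B, B * A and B * B, which together inject into A, can be sent
    to B. *)
Lemma card_square (K : Type) :
  infinite_card K -> [set: K * K] #<= [set: K].
Proof.
move=> /infinite_card_injP[u uI].
have [M [MG Mmax]] := Zorn_bigcup (@square_graph_bigcup K).
have M0 : M !=set0.
  apply: contrapT => /set0P/negP/negPn/eqP M0.
  have [N NG [t Nt]] := square_graph_nat _ _ uI.
  apply: (Mmax N) NG; rewrite M0; split; first exact: sub0set.
  by move=> /(_ _ Nt).
have [Mfun Minj Mdom Mtot /(_ M0) Ainf] := MG.
pose A := square_dom K M; have {}Ainf : infinite_set A by [].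
have /choice[f fP] : forall p : K * K, exists y, A p.1 -> A p.2 -> M (p, y).
  move=> [x x']; have [[Ax Ax']|nA] := pselect (A x /\ A x').
    by have [y My] := Mtot _ _ Ax Ax'; exists y.
  by exists x => /= Ax Ax'; case: nA.
have fA x y : A x -> A y -> A (f (x, y)).
  by move=> Ax Ay; have [] := Mdom _ _ _ (fP (x, y) Ax Ay).
have fI x y x' y' : A x -> A y -> A x' -> A y' ->
    f (x, y) = f (x', y') -> x = x' /\ y = y'.
  move=> Ax Ay Ax' Ay' e; have := fP (x', y') Ax' Ay'; rewrite -e.
  by move=> /(Minj _ _ _ (fP (x, y) Ax Ay)) [].
have [a0 [a1 [Aa0 Aa1 a01]]] : exists a0 a1, [/\ A a0, A a1 & a0 <> a1].
  have [a0 Aa0] := infinite_setN0 Ainf; exists a0.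
  have /infinite_setN0[a1 [Aa1 a10]] := infinite_setD Ainf (finite_set1 a0).
  by exists a1; split=> // e; apply: a10.
have [] := card_le_total {x | ~ A x} {x | A x}; last first.
  (* The complement of A contains a copy of A: M is not maximal. *)
  move=> /card_le_setTP[h0 h0I].
  have /choice[h hP] : forall x, exists y,
      forall Ax : A x, y = sval (h0 (exist _ x Ax)).
    move=> x; have [Ax|nAx] := pselect (A x).
      exists (sval (h0 (exist _ x Ax))) => Ax'.
      by rewrite (Prop_irrelevance Ax' Ax).
    by exists x.
  have hA x : A x -> ~ A (h x) by move=> Ax; rewrite (hP _ Ax); exact: (svalP (h0 _)).
  have hI x y : A x -> A y -> h x = h y -> x = y.
    by move=> Ax Ay; rewrite (hP _ Ax) (hP _ Ay) => /sval_inj /h0I [].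
  pose A' := A `|` h @` A.
  (* j injects A' = A + h(A) into A; the two summands are told apart by the
     first argument of f. *)
  have /choice[j jP] : forall x, exists y, A' x ->
      (A x -> y = f (a0, x)) /\ (forall z, A z -> x = h z -> y = f (a1, z)).
    move=> x; have [Ax|nAx] := pselect (A x).
      exists (f (a0, x)) => _; split=> // z Az xz.
      by case: (hA _ Az); rewrite -xz.
    have [[z Az <-]|nhA] := pselect ((h @` A) x).
      exists (f (a1, z)) => _; split=> [|z' Az' /hI -> //].
      by move=> /(hA _ Az).
    by exists x; case.
  have jA x : A' x -> A (j x).
    move=> A'x; have [jl jr] := jP _ A'x; case: A'x => [Ax|[z Az zx]].
      by rewrite (jl Ax); apply: fA.
    by rewrite (jr z Az) //; apply: fA.
  have jI x y : A' x -> A' y -> j x = j y -> x = y.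
    move=> A'x A'y; have [jlx jrx] := jP _ A'x; have [jly jry] := jP _ A'y.
    case: A'x => [Ax|[z Az zx]]; case: A'y => [Ay|[z' Az' zy]].
    - by rewrite (jlx Ax) (jly Ay) => /fI[].
    - by rewrite (jlx Ax) (jry z' Az') // => /fI[].
    - by rewrite (jrx z Az) // (jly Ay) => /fI[//|//|//|//|/esym].
    - rewrite (jrx z Az) // (jry z' Az') // => /fI[//|//|//|//|_ zz'].
      by rewrite -zx -zy zz'.
  pose g x y := f (j x, j y).
  have gA x y : A' x -> A' y -> A (g x y) by move=> ? ?; apply: fA; apply: jA.
  pose N := M `|` [set t : K * K * K | exists x y,
    [/\ A' x, A' y, ~ (A x /\ A y) & t = (x, y, h (g x y))]].
  have domN x : square_dom K N x <-> A' x.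
    split=> [[y [Mx|[x' [y' [? ? _ [-> _ _]]]]]]|] //; first by left; exists y.
    move=> A'x; have [Ax|nAx] := pselect (A x).
      by have [y My] := Ax; exists y; left.
    by exists (h (g x x)); right; exists x, x; split=> // -[].
  exfalso; apply: (Mmax N).
    split=> [t Mt|NM]; first by left.
    have A'h : A' (h a0) by right; exists a0.
    have [y Ny] := (domN (h a0)).2 A'h.
    by apply: (hA _ Aa0); exists y; apply: NM.
  split.
  - move=> p y y' [My|[x1 [x2 [A1 A2 A12 [pE ->]]]]].
      move=> [|[x1 [x2 [A1 A2 A12 [pE _]]]]]; first exact: Mfun My.
      by case: A12; move: My; rewrite pE => /Mdom[].
    move=> [My|[z1 [z2 [_ _ _ [+ ->]]]]].
      by case: A12; move: My; rewrite pE => /Mdom[].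
    by rewrite pE => -[-> ->].
  - move=> p p' y [My|[x1 [x2 [A1 A2 A12 [-> yE]]]]].
      move=> [|[x1 [x2 [A1 A2 A12 [pE yE]]]]]; first exact: Minj My.
      exfalso; apply: (hA _ (gA _ _ A1 A2)); rewrite -yE.
      by case: p My => ? ? /Mdom[].
    move=> [My|[z1 [z2 [B1 B2 _ [-> yE']]]]].
      exfalso; apply: (hA _ (gA _ _ A1 A2)); rewrite -yE.
      by case: p' My => ? ? /Mdom[].
    move: yE; rewrite yE' => /(hI _ _ (gA _ _ B1 B2) (gA _ _ A1 A2)).
    move=> /(fI _ _ _ _ (jA _ B1) (jA _ B2) (jA _ A1) (jA _ A2))[].
    by move=> /(jI _ _ B1 A1) -> /(jI _ _ B2 A2) ->.
  - move=> x x' y [/Mdom[? ? ?]|[x1 [x2 [A1 A2 A12 [-> -> ->]]]]].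
      by split; apply/domN; left.
    split; apply/domN => //; right; exists (g x1 x2) => //; exact: gA.
  - move=> x x' /domN A'x /domN A'x'.
    have [[Ax Ax']|nA] := pselect (A x /\ A x').
      by have [y My] := Mtot _ _ Ax Ax'; exists y; left.
    by exists (h (g x x')); right; exists x, x'.
  - move=> _; apply: sub_infinite_set Ainf => x Ax; apply/domN; by left.
(* The complement of A injects into A: q injects K into A. *)
move=> /card_le_setTP[h hI].
pose q x := match pselect (A x) with
  | left _ => f (a0, x) | right n => f (a1, sval (h (exist _ x n))) end.
have qA x : A (q x).
  by rewrite /q; case: pselect => n; apply: fA => //; apply: svalP.
have qI : injective q.
  move=> x y; rewrite /q; case: pselect => nx; case: pselect => ny.
  - by move=> /fI[].
  - by move=> /fI[//|//|//||]; first exact: svalP.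
  - by move=> /fI[//||//|//|/esym]; first exact: svalP.
  - by move=> /fI[//||//|| _ /sval_inj/hI[]//]; exact: svalP.
apply/card_le_setTP; exists (fun p => f (q p.1, q p.2)) => -[x y] [x' y'] /=.
by move=> /fI[] // /qI -> /qI ->.
Qed.

Lemma card_seq (K : Type) : infinite_card K -> [set: seq K] #<= [set: K].
Proof.
move=> Kinf; have [u uI] := (infinite_card_injP K).1 Kinf.
have [p pI] := (card_le_setTP _ _).1 (card_square _ Kinf).
pose fold s := foldr (fun x a => p (x, a)) (u 0%N) s.
have foldI s t : size s = size t -> fold s = fold t -> s = t.
  elim: s t => [|x s IH] [|y t] //= [st] /pI[-> e].
  by rewrite (IH t).
(* A sequence is coded by its length together with its right fold by the
   pairing p, which is injective on sequences of a given length. *)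
apply/card_le_setTP; exists (fun s => p (u (size s), fold s)).
by move=> s t /pI[/uI st]; exact: foldI.
Qed.

Lemma card_pow_uncurry (K L M : Type) :
  [set: K -> L -> M] #<= [set: K * L -> M].
Proof.
apply/card_le_setTP; exists (fun f p => f p.1 p.2) => f g fg.
by apply/funext => k; apply/funext => l; exact: (congr1 (@^~ (k, l)) fg).
Qed.

Lemma card_le_const (K L : Type) : K -> [set: L] #<= [set: K -> L].
Proof.
move=> k; apply/card_le_setTP; exists (fun l _ => l) => l l'.
by move=> /(congr1 (@^~ k)).
Qed.

Lemma card_bool_le (L : Type) : infinite_card L -> [set: bool] #<= [set: L].
Proof.
move=> /infinite_card_injP[u uI]; apply/card_le_setTP.
by exists (fun b => u (nat_of_bool b)) => -[] [] // /uI.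
Qed.

Lemma card_option_le (L : Type) : infinite_card L -> [set: option L] #<= [set: L].
Proof.
move=> Linf; apply: card_le_trans (card_seq _ Linf); apply/card_le_setTP.
by exists (fun o => if o is Some x then [:: x] else [::]) => -[x|] [y|] // [->].
Qed.

Lemma infinite_card_le (K L : Type) :
  [set: K] #<= [set: L] -> infinite_card K -> infinite_card L.
Proof. by rewrite /infinite_card !infiniteP => KL /card_le_trans; apply. Qed.

Lemma infinite_card_pow (K L : Type) : K -> infinite_card L ->
  infinite_card (K -> L).
Proof. by move=> k; apply: infinite_card_le; exact: card_le_const. Qed.

Lemma card_pow_pow (K L : Type) : infinite_card K -> infinite_card L ->
  [set: K -> K -> L] #<= [set: K -> L].
Proof.
move=> Kinf /infinite_card_injP[u _]; apply: card_le_trans (card_pow_uncurry _ _ _) _.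
by apply: card_le_fun (card_square _ Kinf) (card_lexx _); exact: u 0%N.
Qed.

(** * Closure under infinitary operations *)

(** Well-founded trees whose inner nodes carry a label in S and have one
    branch for each element of P. *)
Inductive wtree (S P : Type) : Type :=
| Leaf
| Node of S & (P -> wtree S P).

(** The label found at the end of a finite path; [None] marks a leaf, and is
    also returned on every path that runs through one. *)
Fixpoint wtree_label (S P : Type) (t : wtree S P) (s : seq P) : option S :=
  match t, s with
  | Leaf, _ => None
  | Node a _, [::] => Some a
  | Node _ b, p :: s' => wtree_label S P (b p) s'
  end.

Lemma wtree_label_inj (S P : Type) : injective (wtree_label S P).
Proof.
elim=> [|a b IH] [|a' b'] // e; try by have := congr1 (@^~ [::]) e.
have [->] := congr1 (@^~ [::]) e; congr Node; apply/funext => p.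
by apply: IH; apply/funext => s; exact: (congr1 (@^~ (p :: s)) e).
Qed.

(** A set generated from one point by operations of arity K indexed by
    K -> L is no larger than K -> L: its elements are the values of
    well-founded trees, and a tree is determined by its labels along finite
    paths, an element of seq K -> option (K -> L). *)
Lemma closed_under_operations (T K L : Type) (x0 : T)
    (op : (K -> L) -> (K -> T) -> T) : infinite_card K -> infinite_card L ->
  exists A : set T, [/\ A x0, A #<= [set: K -> L] &
    forall l w, (forall k, A (w k)) -> A (op l w)].
Proof.
move=> Kinf Linf; have [u _] := (infinite_card_injP K).1 Kinf.
have [v _] := (infinite_card_injP L).1 Linf.
pose ev := fix ev (t : wtree (K -> L) K) : T :=
  match t with Leaf => x0 | Node l b => op l (fun k => ev (b k)) end.
exists (range ev); split; first by exists (Leaf _ _).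
- apply: card_le_trans (card_image_le _ _) _.
  apply: (@card_le_trans _ _ _ [set: K -> (K -> L)]); last exact: card_pow_pow.
  apply: card_le_trans (card_le_inj (wtree_label_inj _ _)) _.
  apply: card_le_fun; [by move=> _; exact: v 0%N|exact: card_seq|].
  by apply: card_option_le; apply: infinite_card_pow => //; exact: u 0%N.
- move=> l w Aw; have /choice[b bP] : forall k, exists t, ev t = w k.
    by move=> k; have [t _ tw] := Aw k; exists t.
  exists (Node _ _ l b) => //=; congr op; apply/funext => k.
  exact: bP.
Qed.

(** * Density of quasiregular spaces *)

Lemma closure_meets_open {X : topologicalType} (A U : set X) (x : X) :
  open_nbhs x U -> closure A x -> A `&` U !=set0.
Proof. by move=> xU; apply; exact: open_nbhs_nbhs. Qed.

Lemma closureP_open {X : topologicalType} (A : set X) (x : X) :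
  (forall U, open_nbhs x U -> A `&` U !=set0) -> closure A x.
Proof.
move=> AU V; rewrite nbhsE => -[U xU UV].
by have [y [Ay Uy]] := AU _ xU; exists y; split=> //; exact: UV.
Qed.

(** The density of a quasiregular space is at most the pi-character to the
    power of the cellularity. *)
Lemma quasiregular_density {X : topologicalType} (C L : Type) :
  quasiregular X -> infinite_card C -> infinite_card L ->
  (forall G : set (set X), cellular_family G -> G #<= [set: C]) ->
  (forall x : X, [set: pi_char_at x] #<= [set: L]) ->
  exists D : set X, closure D = setT /\ D #<= [set: C -> L].
Proof.
move=> Xqr Cinf Linf CX LX.
have [[x0 _]|X0] := pselect (exists x : X, True); last first.
  exists set0; split=> //; rewrite -subTset => x _.
  by case: X0; exists x.
have /choice[b bP] : forall x : X, exists b : L -> set X,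
    (forall l, open (b l) /\ b l !=set0) /\
    (forall U, open_nbhs x U -> exists l, b l `<=` U).
  move=> x; have [[B [Bopen Bbase] BK] _] := pi_char_atP x.
  have BL : B #<= [set: L] by rewrite (card_le_eql BK).
  have [|g gB] := card_le_range _ _ _ _ BL.
    by have [V BV _] := Bbase _ (open_nbhsT x); exists V.
  exists g; split=> [l|U /Bbase[V]]; first by apply: Bopen; rewrite -gB; exists l.
  by rewrite -gB => -[l _ <-] lU; exists l.
pose W l w := \bigcup_(c in [set: C]) b (w c) (l c).
(* The value of op0 (l, w) is irrelevant when the union W l w is dense. *)
have /choice[op0 opP] : forall lw : (C -> L) * (C -> X), exists y,
    closure (W lw.1 lw.2) <> setT -> ~ closure (W lw.1 lw.2) y.
  move=> [l w] /=; have [->|] := pselect (closure (W l w) = setT).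
    by exists x0.
  rewrite -subTset => /existsNP[y /not_implyP[_ ny]].
  by exists y.
have [D [Dx0 Dle Dcl]] :=
  closed_under_operations _ _ _ x0 (fun l w => op0 (l, w)) Cinf Linf.
exists D; split=> //; rewrite -subTset => y _; apply: contrapT => nDy.
have [||V [Vopen [v Vv] VD]] := Xqr (~` closure D).
- exact/closed_openC/closed_closure.
- by exists y.
pose G B := exists a l, [/\ D a, B = b a l & B `&` V = set0].
have [E [EG Etriv Emax]] := ex_maximal_disjoint_subcollection id G.
(* The union of the maximal disjoint subfamily E of G accumulates at every
   point of D. *)
have EU a U : D a -> open_nbhs a U -> exists2 B, E B & B `&` U !=set0.
  move=> Da [Uopen Ua].
  have [_ /(_ (U `&` ~` closure V))[|l lUV]] := bP a.
    split; first by apply: openI => //; exact/closed_openC/closed_closure.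
    by split=> // /VD; apply; exact: subset_closure.
  have lU : b a l `<=` U by move=> z /lUV[].
  have [lopen [z lz]] := (bP a).1 l.
  have Gl : G (b a l).
    exists a, l; split=> //; rewrite -subset0 => z' [/lUV[_ nVz'] Vz'].
    by apply: nVz'; exact: subset_closure.
  have [El|nEl] := pselect (E (b a l)).
    by exists (b a l) => //; exists z; split=> //; exact: lU.
  apply: contrapT => nE; apply: (Emax (E `|` [set b a l])).
  - split=> [B EB|/(_ (b a l))]; first by left.
    by move=> h; apply/nEl/h; right.
  - by move=> B [/EG|->].
  - have disj B : E B -> B `&` b a l !=set0 -> False.
      move=> EB [z' [Bz' /lU Uz']]; apply: nE; exists B => //.
      by exists z'.
    move=> B B' [EB|->] [EB'|->] // BB'; first exact: Etriv.
    + by case: (disj _ EB BB').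
    + by case: (disj _ EB'); rewrite setIC.
have EC : E #<= [set: C].
  apply: CX; split=> // B /EG[a [l [_ -> _]]]; exact: (bP a).1.
have [|g gE] := card_le_range _ _ _ _ EC.
  by have [B EB _] := EU _ _ Dx0 (open_nbhsT _); exists B.
have /choice[wl wlP] : forall c, exists al : X * L,
    [/\ D al.1, g c = b al.1 al.2 & g c `&` V = set0].
  move=> c; have [|a [l [? ? ?]]] := EG (g c); first by rewrite -gE; exists c.
  by exists (a, l).
pose w c := (wl c).1; pose l c := (wl c).2.
have Dw c : D (w c) by have [] := wlP c.
apply: (opP (l, w)) => /=.
  move=> Wl; have : closure (W l w) v by rewrite Wl.
  move=> /(_ _ (open_nbhs_nbhs (conj Vopen Vv)))[z [[c _ cz] Vz]].
  have [_ gc] := wlP c; rewrite -subset0 => /(_ z); apply.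
  by rewrite gc.
apply: closureP_open => U xU.
have [B] := EU _ _ (Dcl l w Dw) xU.
rewrite -gE => -[c _ <-] [z [cz Uz]]; exists z; split=> //.
by exists c => //; have [_ <-] := wlP c.
Qed.

(** * Approximation by few points, and counting *)

(** A dense set of size at most T can be replaced by a set E of size at most
    2 ^ W * 2 ^ W * T whose closure is reached by subsets of size at most W:
    collect, for each C in the cover and each d in D, at most 2 ^ W points of
    C clustering at d. *)
Lemma weak_tightness_net {X : topologicalType} (W T : Type) (D : set X) :
  weak_tightness_prop X W -> closure D = setT -> D #<= [set: T] ->
  exists E : set X, E #<= [set: (W -> bool) * (W -> bool) * T] /\
    forall x, exists B, [/\ B `<=` E, B #<= [set: W] & closure B x].
Proof.
move=> [CC [CCX CCle CCP]] DX DT.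
have [[x0 _]|X0] := pselect (exists x : X, True); last first.
  by exists set0; split=> // x; case: X0; exists x.
have [|d dD] := card_le_range _ _ _ _ DT.
  have : closure D x0 by rewrite DX.
  by move=> /(_ _ filterT)[y []]; exists y.
have [|cc ccE] := card_le_range _ _ _ _ CCle.
  have : [set: X] x0 by []; rewrite -CCX => -[C CCC _].
  by exists C.
have /choice[b bP] : forall ut : (W -> bool) * T, exists b : (W -> bool) -> X,
    range b `<=` cc ut.1 /\ closure (range b) (d ut.2).
  move=> [u t] /=; have CCu : CC (cc u) by rewrite -ccE; exists u.
  have [_ cl] := CCP _ CCu.
  have : [set: X] (d t) by []; rewrite -cl => -[B [BC Ble] dB].
  have [|b bB] := card_le_range _ _ _ _ Ble; last by exists b; rewrite bB.
  by have [y [By _]] := dB _ filterT; exists y.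
pose e p := b (p.1.1, p.2) p.1.2.
exists (range e); split; first exact: card_image_le.
move=> x; have : [set: X] x by []; rewrite -CCX => -[C CCC Cx].
have [u _ uC] : range cc C by rewrite ccE.
have [tC _] := CCP _ CCC; have [[_ tP] _] := tightnessP C.
pose A : set C := [set y | range e (set_val y)].
pose x' : C := SigSub (mem_set Cx).
(* The trace A of E on C is dense in the subspace C. *)
have Ax' : closure A x'.
  apply: closureP_open => U' [[U Uopen <-] Ux].
  have : closure D x by rewrite DX.
  move=> /(closure_meets_open _ _ _ (conj Uopen Ux))[y [+ Uy]].
  rewrite -dD => -[t _ ty]; have [bC bcl] := bP (u, t).
  move: bcl; rewrite /= ty => /(closure_meets_open _ _ _ (conj Uopen Uy)).
  move=> [z [[v _ vz] Uz]]; rewrite /= uC in bC.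
  have Cz : C z by apply: bC; exists v.
  exists (SigSub (mem_set Cz)); split=> //=.
  by exists (u, v, t).
have [B [BA Ble Bx']] := tP _ _ Ax'.
exists (set_val @` B); split.
- by move=> _ [y By <-]; exact: BA.
- exact: card_le_trans (card_image_le _ _) (card_le_trans Ble tC).
- apply: closureP_open => U [Uopen Ux].
  have [|y [By Uy]] := closure_meets_open B (set_val @^-1` U) x' _ Bx'.
    by split=> //; exists U.
  by exists (set_val y); split=> //; exists y.
Qed.

Lemma card_le_finite_fibers (X Y : Type) (F : X -> Y) :
  (forall y, finite_set (F @^-1` [set y])) -> [set: X] #<= [set: Y * nat].
Proof.
move=> Ffin; have /choice[c cI] : forall y, exists c : X -> nat,
    {in F @^-1` [set y] &, injective c}.
  by move=> y; apply/countable_injP/finite_set_countable.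
apply/card_le_setTP; exists (fun x => (F x, c (F x) x)) => x x' [FF].
by rewrite FF; apply: cI; apply/mem_set.
Qed.

(** A point x is coded by the traces, on a W-sequence of points of E
    clustering at x, of the neighbourhoods V(alpha, x). If distinct points
    x_1, ..., x_n had the same code, then x_1 would lie in the closure of
    every V(alpha, x_i); so fewer than n points share a code. *)
Lemma card_le_closed_pseudochar {X : topologicalType} (n : nat)
    (P W Z : Type) (E : set X) : (0 < n)%N ->
  n_closed_pseudo_prop X n P -> E #<= [set: Z] ->
  (forall x, exists B, [/\ B `<=` E, B #<= [set: W] & closure B x]) ->
  [set: X] #<= [set: (P * W -> option Z) * nat].
Proof.
move=> n_gt0 [V Vnbhs V0] EZ EB.
have [E0|/set0P E0] := eqVneq E set0.
  suff -> : [set: X] = set0 by exact: card_ge0.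
  rewrite -subset0 => x _; have [B [BE _]] := EB x.
  by move=> /(_ _ filterT)[y [/BE]]; rewrite E0.
have [e eE] := card_le_range _ _ _ E0 EZ.
have /choice[s sP] : forall x, exists s : W -> Z, closure (range (e \o s)) x.
  move=> x; have [B [BE BW Bx]] := EB x.
  have [|g gB] := card_le_range _ _ _ _ BW.
    by have [y [By _]] := Bx _ filterT; exists y.
  have /choice[s sg] : forall w, exists z, e z = g w.
    move=> w; have : range e (g w) by rewrite eE; apply: BE; rewrite -gB; exists w.
    by move=> [z _ zg]; exists z.
  exists s; have -> : e \o s = g by apply/funext => w; exact: sg.
  by rewrite gB.
pose F x (pw : P * W) :=
  if pselect (V pw.1 x (e (s x pw.2))) then Some (s x pw.2) else None.
apply: (@card_le_finite_fibers _ _ F) => y; apply: contrapT.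
move=> /infiniteP/card_leP[f].
pose a (i : 'I_n) : X := val (f (SigSub (mem_set (I : [set: nat] (val i))))).
have aI : injective a.
  move=> i j /val_inj fij; apply: val_inj.
  by have /(congr1 val) := @inj _ _ _ f _ _ (mem_set I) (mem_set I) fij.
have Fa i : F (a i) = y.
  exact: (set_mem (valP (f (SigSub (mem_set (I : [set: nat] (val i))))))).
pose i0 := Ordinal n_gt0.
have := V0 a aI; rewrite -subset0 => /(_ (a i0)); apply=> i _ p _.
apply: closureP_open => U [Uopen Ua].
have [Vopen Va] := Vnbhs p (a i0).
have := closure_meets_open _ _ _ (conj (openI Uopen Vopen) (conj Ua Va)) (sP _).
move=> [z [[w _ <-] [/= Uw Vw]]].
exists (e (s (a i0) w)); split=> //.
have : F (a i) (p, w) = F (a i0) (p, w) by rewrite !Fa.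
rewrite /F /=; case: pselect => [Viw|?]; case: pselect => //= ?.
by move=> [<-].
Qed.

Theorem theorem3p23 (n : nat) (n_ge2 : (2 <= n)%N) (X : topologicalType)
    (X_urysohn : n_urysohn X n) (X_quasiregular : quasiregular X) :
  [set: X] #<=
  [set: cellularity X * weak_tightness X * n_closed_pseudochar X n ->
        pi_char X].
Proof.
have [[Cinf CX] _] := cellularityP X.
have [[Winf WX] _] := weak_tightnessP X.
have [[Pinf PX] _] := n_closed_pseudocharP X_urysohn.
have [[Linf LX] _] := pi_charP X.
set C := cellularity X in Cinf CX *; set W := weak_tightness X in Winf WX *.
set P := n_closed_pseudochar X n in Pinf PX *; set L := pi_char X in Linf LX *.
have [c0 _] := infinite_setN0 Cinf; have [w0 _] := infinite_setN0 Winf.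
have [p0 _] := infinite_setN0 Pinf; have [l0 _] := infinite_setN0 Linf.
pose K := (C * W * P)%type.
have CK : [set: C] #<= [set: K].
  by apply: (@card_le_inj _ _ (fun c => (c, w0, p0))) => ? ? [].
have WK : [set: W] #<= [set: K].
  by apply: (@card_le_inj _ _ (fun w => (c0, w, p0))) => ? ? [].
have PWK : [set: P * W] #<= [set: K].
  by apply: (@card_le_inj _ _ (fun pw => (c0, pw.2, pw.1))) => -[? ?] [? ?] [-> ->].
have Kinf : infinite_card K := infinite_card_le _ _ CK Cinf.
pose M := K -> L; have Minf : infinite_card M.
  by apply: infinite_card_pow => //; exact: (c0, w0, p0).
have MM := card_square _ Minf.
have WM : [set: W -> bool] #<= [set: M].
  by apply: card_le_fun => //; exact: card_bool_le.
have [D [DX DCL]] := quasiregular_density _ _ X_quasiregular Cinf Linf CX LX.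
have CLM : [set: C -> L] #<= [set: M] by exact: card_le_fun.
have [E [EZ EB]] := weak_tightness_net _ _ _ WX DX DCL.
apply: card_le_trans (card_le_closed_pseudochar _ _ _ _ _ (ltnW n_ge2) PX EZ EB) _.
apply: (card_le_trans _ MM); apply: card_le_prod; last exact/infiniteP.
apply: (@card_le_trans _ _ _ [set: K -> M]); last exact: card_pow_pow.
apply: card_le_fun => //.
apply: card_le_trans (card_option_le _ Minf); apply: card_le_option.
apply: (card_le_trans _ MM); apply: card_le_prod CLM.
by apply: (card_le_trans _ MM); exact: card_le_prod.
Qed.
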